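(* Let $(\rho_r)_{r\in\mathbb N}$ be a sequence of complex numbers. There exists a time-homogeneous Markov process $(B_t)_{t\in\mathbb N}$ on $\mathbb T$, with the uniform distribution on $[0,1]$ as a stationary distribution, such that for all $t\in\mathbb Z_+$, $r\in\mathbb N$ and $a\in[0,1]$ $$\mathbb E\big[e^{2\pi i r B_{t}}\mid B_{t-1}=a\big]=\rho_r\,e^{2\pi i r a},$$ if and only if there is a random variable $W$ on $[0,1]$ such that $$\rho_r=\mathbb E\big[e^{2\pi i rW}\big],\qquad r\in\mathbb N.$$
   Context: $\mathbb T=\mathbb R/\mathbb Z$ is the one-dimensional torus group; points of $\mathbb T$ are represented by elements of $[0,1]$ with $0$ and $1$ identified. $\mathbb N=\{0,1,2,\ldots\}$ and $\mathbb Z_+=\{1,2,\ldots\}$. Time-homogeneous means that the one-step transition kernel does not depend on $t$; the conditional expectation given $B_{t-1}=a$ is the integral with respect to this kernel started from $a$. The displayed equation says that the functions $b\mapsto e^{2\pi i r b}$ are eigenfunctions (''eigenvectors'') of the transition kernel with eigenvalues $\rho_r$. *)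

(* Defs.v *)
From HB Require Import structures.
From mathcomp Require Import all_boot all_order all_algebra ring_quotient.
From mathcomp Require Import all_classical all_reals all_analysis.
From mathcomp Require Import measurable_realfun.
From mathcomp Require Import complex.

Set Implicit Arguments.
Unset Strict Implicit.
Unset Printing Implicit Defensive.

Import Order.TTheory GRing.Theory Num.Theory.
Import numFieldNormedType.Exports.

Local Open Scope classical_set_scope.
Local Open Scope ring_scope.
Local Open Scope complex_scope.
Local Open Scope quotient_scope.

(* The predicate underlying [Num.int]: the integers as a subgroup of R. *)
Definition int_subgroup (R : realType) : zmodClosed R :=
  (Num.int_num_subdef : {pred R}).

(* The group R / Z with the quotient topology and its Borel sigma-algebra. *)
Definition torus (R : realType) : Type :=
  quotient_topology (Quotient.quot (int_subgroup R)).

HB.instance Definition _ (R : realType) := Topological.on (torus R).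
HB.instance Definition _ (R : realType) := Quotient.on (torus R).
HB.instance Definition _ (R : realType) :=
  GRing.Zmodule.copy (torus R) (Quotient.quot (int_subgroup R)).
HB.instance Definition _ (R : realType) := isPointed.Build (torus R) 0.
HB.instance Definition _ (R : realType) :=
  @isMeasurable.Build (sigma_display (@open (torus R))) (torus R)
    <<s (@open (torus R)) >>
    (@sigma_algebra0 _ setT _) (@sigma_algebraC _ _)
    (@sigma_algebra_bigcup _ setT _).

Definition torus_pi {R : realType} (x : R) : torus R := \pi_(torus R) x.

Lemma torus_piP (R : realType) (x y : R) :
  torus_pi x = torus_pi y <-> x - y \is a Num.int.
Proof.
have e : (x - y \is a Num.int) = _ := Quotient.idealrBE (int_subgroup R) x y.
by rewrite e; split=> [h|/eqP h]; [exact/eqP|exact: h].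
Qed.

Lemma torus_piD (R : realType) (x y : R) :
  torus_pi (x + y) = torus_pi x + torus_pi y.
Proof. exact: (raddfD (\pi_(Quotient.quot (int_subgroup R)))). Qed.

Lemma measurable_torus_pi (R : realType) :
  measurable_fun [set: R] (@torus_pi R).
Proof.
apply: (@measurability _ _ _ _ setT _ (@open (torus R))) => // _ [U oU <-].
by rewrite setTI; apply: open_measurable; exact: oU.
Qed.

(* The library's measures on R live on [measurableTypeR R]. *)
Definition torus_mfun (R : realType) : {mfun measurableTypeR R >-> torus R} :=
  HB.pack (torus_pi : measurableTypeR R -> torus R)
    (isMeasurableFun.Build _ _ (measurableTypeR R) (torus R) torus_pi
       (@measurable_torus_pi R)).

Definition torus_uniform (R : realType) : probability (torus R) R :=
  distribution (uniform_prob (@ltr01 R)) (torus_mfun R).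

Definition expi2pi {R : realType} (x : R) : R[i] :=
  cos (2 * pi * x) +i* sin (2 * pi * x).

(* b |-> e^{2 i pi r b}; by [torus_charE] it does not depend on the choice of
   the representative [repr b]. *)
Definition torus_char {R : realType} (r : nat) (b : torus R) : R[i] :=
  expi2pi (r%:R * (repr b : R)).

Lemma expi2piDn (R : realType) (x : R) (n : nat) :
  expi2pi (x + n%:R) = expi2pi x.
Proof.
have e : 2 * pi * (x + n%:R) = 2 * pi * x + (pi *+ 2) *+ n :> R.
  by rewrite mulrDr mulr_natr -[pi *+ 2]mulr_natl.
by rewrite /expi2pi e (periodicn (@cosD2pi R)) (periodicn (@sinD2pi R)).
Qed.

Lemma torus_charE (R : realType) (r : nat) (x : R) :
  torus_char r (torus_pi x) = expi2pi (r%:R * x).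
Proof.
rewrite /torus_char; set y := repr _.
have : torus_pi y = torus_pi x by rewrite /torus_pi reprK.
move=> /torus_piP /intrP[m yxm].
have {yxm}-> : y = x + m%:~R by rewrite -yxm addrC subrK.
case: (intP m) => [|n|n]; first by rewrite addr0.
- by rewrite mulrDr -natrM expi2piDn.
- by rewrite -(expi2piDn _ (r * n.+1)) mulrDr rmorphN /= mulrN natrM subrK.
Qed.

Definition cintegral d (T : measurableType d) (R : realType)
    (mu : {measure set T -> \bar R}) (f : T -> R[i]) : R[i] :=
  (\int[mu]_x complex.Re (f x)) +i* (\int[mu]_x complex.Im (f x)).

Section markov_process.
Context d d' (Omega : measurableType d) (S : measurableType d') (R : realType).
Implicit Types (P : probability Omega R) (K : nat -> R.-pker S ~> S).

(* The sigma-algebra generated by B_0, ..., B_t. *)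
Definition history P (B : nat -> {RV P >-> S}) (t : nat) : set (set Omega) :=
  <<s [set F | exists s A, [/\ (s <= t)%N, measurable A & F = B s @^-1` A]] >>.

(* [K t] is the transition kernel from time t to time t + 1: the function
   w |-> K t (B t w) A is a version of the conditional probability of
   B_(t+1) \in A given B_0, ..., B_t. *)
Definition markov_process P (B : nat -> {RV P >-> S}) K :=
  forall t F A, history B t F -> measurable A ->
    P (F `&` B t.+1 @^-1` A) = (\int[P]_(w in F) K t (B t w) A)%E.

Definition time_homogeneous K :=
  forall t a A, measurable A -> K t a A = K 0%N a A.

Definition stationary_distribution K (mu : probability S R) :=
  forall t A, measurable A -> (\int[mu]_a K t a A)%E = mu A.

(* E[f(B_t) | B_(t-1) = a], for t > 0. *)
Definition cond_expectation K (t : nat) (f : S -> R[i]) (a : S) : R[i] :=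
  cintegral (K t.-1 a) f.

End markov_process.

(* Main.v *)
(** If the chain exists, then [W] can be given the law of the kernel started at
    [0], transported to [0, 1[ by the fractional part.  Conversely, let the kernel
    send [a] to the law of [a + W]: characters turn this sum into a product, and
    the uniform law is invariant under translations.  The chain itself is the
    random walk started at [0], with independent steps distributed as [W].  The
    binary digits of a uniform number are independent fair coins; arranged in a
    double array, each row encodes again a uniform number, whose image under the
    quantile function of [W] is a step of the walk. *)

Require Import Defs.
From HB Require Import structures.
From mathcomp Require Import all_boot all_order all_algebra.
From mathcomp Require Import all_classical all_reals all_analysis.
From mathcomp Require Import measurable_realfun complex ring lra zify.

Set Implicit Arguments.
Unset Strict Implicit.
Unset Printing Implicit Defensive.

Import Order.TTheory GRing.Theory Num.Theory.
Import numFieldNormedType.Exports.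

Local Open Scope classical_set_scope.
Local Open Scope ring_scope.

(** * The torus *)

Lemma measurable_preimage d d' (T : measurableType d) (T' : measurableType d')
    (f : T -> T') (A : set T') :
  measurable_fun [set: T] f -> measurable A -> measurable (f @^-1` A).
Proof. by move=> mf mA; rewrite -[_ @^-1` _]setTI; exact: mf. Qed.

Section torus.
Context {R : realType}.

Lemma torus_pi_int (x : R) (m : int) : torus_pi (x + m%:~R) = torus_pi x.
Proof. by apply/torus_piP; rewrite addrC addKr intr_int. Qed.

(** The saturation of [U] is the union of its integer translates, each of them open. *)
Lemma open_torus_pi (U : set R) : open U -> open (torus_pi @` U).
Proof.
move=> oU; rewrite /open /= /quotient_open.
rewrite (_ : _ @^-1` _ =
    \bigcup_(m in [set: int]) ((fun x => x + m%:~R) @^-1` U)).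
  apply: bigcup_open => m _; apply: open_comp => // x _.
  by apply: continuousD; [exact: cvg_id|exact: cst_continuous].
apply/seteqP; split => [x [y Uy]|x [m _ /= Uxm]].
  move=> /torus_piP/intrP[m yxm]; exists m => //=.
  by rewrite -yxm addrC subrK.
by exists (x + m%:~R) => //; exact: torus_pi_int.
Qed.

(** [repr] is an unspecified choice; subtracting its floor yields the canonical representative in
    [0, 1[. *)
Definition torus_frac (b : torus R) : R :=
  (repr b : R) - (Num.floor (repr b : R))%:~R.

Lemma torus_fracK : cancel torus_frac torus_pi.
Proof.
by move=> b; rewrite /torus_frac -rmorphN /= torus_pi_int /torus_pi reprK.
Qed.

Lemma torus_frac_itv b : 0 <= torus_frac b < 1.
Proof.
rewrite /torus_frac subr_ge0 floor_le_tmp /= ltrBlDl.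
by have := floorD1_gt (repr b : R); rewrite intrD.
Qed.

(** Both numbers lie in [0, 1[, so the integer by which they differ is strictly between -1 and 1. *)
Lemma torus_piK (x : R) : 0 <= x < 1 -> torus_frac (torus_pi x) = x.
Proof.
move=> /andP[x0 x1]; have /andP[y0 y1] := torus_frac_itv (torus_pi x).
have /torus_piP/intrP[m yxm] := torus_fracK (torus_pi x).
move: (torus_frac _) y0 y1 yxm => y y0 y1 yxm.
suff m0 : m = 0 by apply/eqP; rewrite -subr_eq0 yxm m0.
have m1 : m < 1 by rewrite -(ltr_int R) -yxm ltrBlDr ltr_wpDr.
have m2 : -1 < m.
  rewrite -(ltr_int R) -yxm rmorphN ltrBrDr addrC (lt_le_trans _ y0)//.
  by rewrite subr_lt0.
by apply/eqP; rewrite eq_le -ltzD1 add0r m1 -[0]/(-1 + 1 : int) lezD1.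
Qed.

(** The fractional part jumps at the class of 0, yet open upper rays have open preimages: the whole
    torus if x < 0, and otherwise the image of ]x, 1[. *)
Lemma measurable_torus_frac : measurable_fun [set: torus R] torus_frac.
Proof.
apply: (measurability _ (RGenOInfty.measurableE R)) => // _ [_ [x ->] <-].
rewrite setTI; have [x0|x0] := ltP x 0.
  rewrite (_ : _ @^-1` _ = setT)//; apply/seteqP; split => // b _ /=.
  rewrite in_itv/= andbT (lt_le_trans x0)//.
  by case/andP: (torus_frac_itv b).
apply: sub_sigma_algebra.
rewrite (_ : _ @^-1` _ = torus_pi @` `]x, 1[).
  by apply: open_torus_pi; exact: interval_open.
apply/seteqP; split => [b|_ [y /= /[!in_itv]/= /andP[xy y1] <-]].
  rewrite /= in_itv/= andbT => xb.
  exists (torus_frac b); last exact: torus_fracK.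
  by rewrite /= in_itv/= xb; case/andP: (torus_frac_itv b).
by rewrite torus_piK ?xy// y1 (le_trans x0 (ltW xy)).
Qed.

(** Computing the sum on the real line through fractional parts avoids comparing the Borel
    sigma-algebra of the product with the product sigma-algebra. *)
Lemma measurable_torus_add :
  measurable_fun [set: torus R * torus R] (fun z => z.1 + z.2).
Proof.
rewrite (_ : (fun _ => _) =
  torus_pi \o (fun z : torus R * torus R => torus_frac z.1 + torus_frac z.2)).
  apply: measurableT_comp; first exact: measurable_torus_pi.
  by apply: measurable_funD; apply: measurableT_comp => //;
    exact: measurable_torus_frac.
by apply/funext => z /=; rewrite torus_piD !torus_fracK.
Qed.

Lemma torus_char_frac r (b : torus R) :
  torus_char r b = expi2pi (r%:R * torus_frac b).
Proof. by rewrite -{1}(torus_fracK b) torus_charE. Qed.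

End torus.

HB.instance Definition _ (R : realType) :=
  isMeasurableFun.Build _ _ _ _ (@torus_frac R) measurable_torus_frac.

Lemma expi2pi0 (R : realType) : expi2pi 0 = 1 :> R[i].
Proof. by rewrite /expi2pi mulr0 cos0 sin0. Qed.

Lemma expi2piD (R : realType) (x y : R) :
  expi2pi (x + y) = expi2pi x * expi2pi y.
Proof.
by rewrite /expi2pi mulrDr cosD sinD [X in (_ +i* X)%C]addrC.
Qed.

(** * Translation invariance of Lebesgue measure and of the uniform law *)

Section translation.
Context {R : realType}.
Local Notation leb := (@lebesgue_measure R).

(** The image measure gives each interval ]a, b] its length, so uniqueness of Lebesgue measure
    applies. *)
Lemma lebesgue_measure_translate (y : R) (A : set R) : measurable A ->
  leb ((fun x => x + y) @^-1` A) = leb A.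
Proof.
have mt : measurable_fun [set: measurableTypeR R]
    ((fun x => x + y) : measurableTypeR R -> measurableTypeR R).
  exact: measurable_funD.
move=> mA; apply/esym; rewrite -[RHS]/(pushforward leb
  ((fun x => x + y) : measurableTypeR R -> measurableTypeR R) A).
apply: lebesgue_measure_unique => //= _ [[a b]] _ <-.
rewrite /pushforward /= (_ : _ @^-1` _ = `]a - y, b - y]%classic).
  rewrite !lebesgue_measure_itv/= !lte_fin ltrD2r.
  by case: ifPn => // _; rewrite -!EFinB opprB addrA subrK.
by apply/seteqP; split=> x /=; rewrite !in_itv/= ltrBlDr lerBrDr.
Qed.

Lemma lebesgue_measure_setI1 (x : R) (A : set R) : measurable A ->
  leb (A `&` [set x]) = 0%E.
Proof.
move=> mA; apply/eqP; rewrite eq_le measure_ge0 andbT.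
rewrite -(lebesgue_measure_set1 x) le_measure ?inE//.
exact: measurableI.
Qed.

(** The density is that of the closed interval; dropping the null point 1 leaves exactly one
    representative of each class of the torus. *)
Lemma uniform_prob01E (E : set R) : measurable E ->
  uniform_prob (@ltr01 R) E = leb (E `&` `[0, 1[).
Proof.
move=> mE; rewrite /uniform_prob.
rewrite integral_uniform_pdf (eq_integral (cst 1%E)); last first.
  move=> x; rewrite inE /= in_itv /= => -[_ x01].
  by rewrite /uniform_pdf x01 subr0 invr1.
rewrite integral_cst /= ?mul1e; last exact: measurableI.
rewrite -(@setUitv1 _ _ _ _ true) ?bnd_simp// setIUr measureU.
- by rewrite [X in (_ + X)%E]lebesgue_measure_setI1 // adde0.
- exact: measurableI.
- exact: measurableI.
- apply/seteqP; split => // x [[_ /= /[!in_itv]/= /andP[_ x1]] [_ /= xe]].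
  by rewrite xe ltxx in x1.
Qed.

(** Dropping the null point 0 as well leaves ]0, 1[, the range on which [quantile] is a genuine
    infimum. *)
Lemma uniform_prob01Eo (E : set R) : measurable E ->
  uniform_prob (@ltr01 R) E = leb (E `&` `]0, 1[).
Proof.
move=> mE; rewrite uniform_prob01E//.
rewrite -(@setU1itv _ _ _ _ false) ?bnd_simp// setIUr measureU.
- by rewrite [X in (X + _)%E]lebesgue_measure_setI1 // add0e.
- exact: measurableI.
- exact: measurableI.
- apply/seteqP; split => // x [[_ /= ->] [_ /=]].
  by rewrite in_itv/= ltxx.
Qed.

Lemma torus_uniformE (A : set (torus R)) : measurable A ->
  torus_uniform R A = leb (torus_pi @^-1` A `&` `[0, 1[).
Proof.
move=> mA; rewrite -uniform_prob01E//.
exact: measurable_preimage (@measurable_torus_pi R) mA.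
Qed.

(** On the line, translation by the fractional part y of [b] carries [0, 1[ to [y, 1 + y[. The part
    beyond 1 is moved back by one period onto [0, y[. *)
Lemma torus_uniform_translate (b : torus R) (A : set (torus R)) :
  measurable A ->
  torus_uniform R ((fun a => a + b) @^-1` A) = torus_uniform R A.
Proof.
move=> mA; have mAb : measurable ((fun a => a + b) @^-1` A).
  exact: measurable_preimage (measurable_fun_pair1 b measurable_torus_add) mA.
have mE : measurable (@torus_pi R @^-1` A).
  exact: measurable_preimage (@measurable_torus_pi R) mA.
rewrite !torus_uniformE//; set E := torus_pi @^-1` A.
have /andP[y0 y1] := torus_frac_itv b; set y := torus_frac b in y0 y1.
have mI (i : interval R) : measurable (E `&` [set` i]) by exact: measurableI.
have -> : torus_pi @^-1` ((fun a => a + b) @^-1` A) `&` `[0, 1[ =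
    (fun x => x + y) @^-1` (E `&` `[y, 1 + y[).
  apply/seteqP; split=> x /=;
    by rewrite !in_itv/= lerDr ltrD2r /E /= torus_piD torus_fracK.
rewrite lebesgue_measure_translate//.
have splitI (a c d : R) : a <= c -> c <= d ->
    leb (E `&` `[a, d[) = (leb (E `&` `[a, c[) + leb (E `&` `[c, d[))%E.
  move=> ac cd; rewrite -measureU; [|exact: mI|exact: mI|].
    rewrite -setIUr; congr (leb (_ `&` _)).
    apply/seteqP; split=> x /=; rewrite !in_itv/=.
      by move=> /andP[ax xd]; case: (ltP x c) => xc; [left|right]; apply/andP.
    by case=> /andP[? ?]; apply/andP; split; lra.
  apply/seteqP; split => // x [[_ /=]] /[swap] -[_ /=].
  by rewrite !in_itv/= => /andP[? _] /andP[_ ?]; lra.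
have y11 : 1 <= 1 + y by rewrite lerDl.
rewrite (splitI _ _ _ (ltW y1) y11) (splitI _ _ _ y0 (ltW y1)) addeC.
congr (_ + _)%E.
rewrite -[LHS](lebesgue_measure_translate 1)//; congr (leb _).
apply/seteqP; split=> x /=; rewrite !in_itv/= /E /= (torus_pi_int x 1).
  by move=> [? /andP[? ?]]; split => //; apply/andP; split; lra.
by move=> [? /andP[? ?]]; split => //; apply/andP; split; lra.
Qed.

End translation.

(** * Complex integrals and characters of the torus *)

Section cintegral.
Context d (T : measurableType d) (R : realType).
Implicit Types mu : {measure set T -> \bar R}.

Definition cintegrable mu (f : T -> R[i]) :=
  mu.-integrable setT (EFin \o (fun x => complex.Re (f x))) /\
  mu.-integrable setT (EFin \o (fun x => complex.Im (f x))).

Lemma cintegralZl mu (c : R[i]) (f : T -> R[i]) : cintegrable mu f ->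
  cintegral mu (fun x => c * f x) = c * cintegral mu f.
Proof.
move=> [iR iI]; case: c => c s; rewrite /cintegral.
have iZ k (g : T -> R) : mu.-integrable setT (EFin \o g) ->
    mu.-integrable setT (EFin \o (fun x => k * g x)).
  by move=> ig; exact: (integrableZl measurableT k ig).
congr (_ +i* _)%C.
  rewrite -!RintegralZl// -RintegralB//; [|exact: iZ|exact: iZ].
  by apply: eq_Rintegral => x _; case: (f x).
rewrite -!RintegralZl// -RintegralD//; [|exact: iZ|exact: iZ].
by apply: eq_Rintegral => x _; case: (f x).
Qed.

Lemma cintegral_distribution d' (T' : measurableType d') (P : probability T R)
    (X : {mfun T >-> T'}) (f : T' -> R[i]) :
  measurable_fun setT (fun x => complex.Re (f x)) ->
  measurable_fun setT (fun x => complex.Im (f x)) ->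
  cintegrable P (f \o X) ->
  cintegral (distribution P X) f = cintegral P (f \o X).
Proof.
move=> mR mI [iR iI]; rewrite /cintegral /Rintegral.
by congr (fine _ +i* fine _)%C; rewrite integral_distribution//;
  exact/measurable_EFinP.
Qed.

End cintegral.

(** Naming the translation lets it carry the measurability instance that [distribution] asks for. *)
Definition torus_shift {R : realType} (b w : torus R) : torus R := b + w.

HB.instance Definition _ (R : realType) (b : torus R) :=
  isMeasurableFun.Build _ _ _ _ (torus_shift b)
    (measurable_fun_pair2 b measurable_torus_add).

Section torus_char.
Context {R : realType}.
Implicit Types (r : nat) (a b : torus R).

Lemma torus_charD r a b :
  torus_char r (a + b) = torus_char r a * torus_char r b.
Proof.
rewrite -(torus_fracK a) -(torus_fracK b) -torus_piD !torus_charE.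
by rewrite mulrDr expi2piD.
Qed.

Lemma measurable_Re_torus_char r :
  measurable_fun [set: torus R] (fun b => complex.Re (torus_char r b)).
Proof.
under eq_fun do rewrite torus_char_frac.
apply: measurableT_comp.
  by apply: continuous_measurable_fun; exact: continuous_cos.
by apply: measurable_funM => //; apply: measurable_funM.
Qed.

Lemma measurable_Im_torus_char r :
  measurable_fun [set: torus R] (fun b => complex.Im (torus_char r b)).
Proof.
under eq_fun do rewrite torus_char_frac.
apply: measurableT_comp.
  by apply: continuous_measurable_fun; exact: continuous_sin.
by apply: measurable_funM => //; apply: measurable_funM.
Qed.

(** Cosine and sine are bounded by 1, and a probability is finite. *)
Lemma cintegrable_torus_char d (T : measurableType d) (P : probability T R) r
    (f : T -> torus R) :
  measurable_fun setT f -> cintegrable P (fun x => torus_char r (f x)).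
Proof.
move=> mf; split; apply: measurable_bounded_integrable => //.
- by rewrite [ltLHS]probability_setT ltry.
- exact: measurableT_comp (measurable_Re_torus_char r) mf.
- exists 1; split => // M M1 x _ /=.
  by rewrite (le_trans _ (ltW M1))// ler_norml cos_geN1 cos_le1.
- by rewrite [ltLHS]probability_setT ltry.
- exact: measurableT_comp (measurable_Im_torus_char r) mf.
- exists 1; split => // M M1 x _ /=.
  by rewrite (le_trans _ (ltW M1))// ler_norml sin_geN1 sin_le1.
Qed.

End torus_char.

(** * The transition kernel of a random walk on the torus *)

Section torus_walk.
Context {R : realType} (mu : probability (torus R) R).

Definition torus_walk (b : torus R) : {measure set (torus R) -> \bar R} :=
  distribution mu (torus_shift b).

(** Seen as the mass of a section of a measurable set in the product, the kernel is measurable in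
    [b] and open to Tonelli's theorem. *)
Lemma torus_walkE (A : set (torus R)) :
  (fun b => torus_walk b A) = mu \o xsection [set z | A (z.1 + z.2)].
Proof.
by apply/funext => b /=; rewrite /xsection; under eq_set do rewrite inE.
Qed.

Let measurable_torus_walk (A : set (torus R)) :
  measurable A -> measurable_fun [set: torus R] (torus_walk ^~ A).
Proof.
move=> mA; rewrite torus_walkE; apply: measurable_fun_xsection.
exact: measurable_preimage measurable_torus_add mA.
Qed.

HB.instance Definition _ := isKernel.Build _ _ _ _ _ torus_walk
  measurable_torus_walk.

Let torus_walk_setT (b : torus R) : torus_walk b [set: torus R] = 1%E.
Proof. exact: probability_setT. Qed.

HB.instance Definition _ := Kernel_isProbability.Build _ _ _ _ _ torus_walk
  torus_walk_setT.

(** By Tonelli the step may be fixed first; translation invariance then makes the inner mass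
    constant, and [mu] has total mass 1. *)
Lemma torus_walk_uniform (A : set (torus R)) : measurable A ->
  (\int[torus_uniform R]_a torus_walk a A)%E = torus_uniform R A.
Proof.
move=> mA; have mS : measurable [set z : torus R * torus R | A (z.1 + z.2)].
  exact: measurable_preimage measurable_torus_add mA.
have := indic_fubini_tonelli (torus_uniform R) mu mS.
rewrite indic_fubini_tonelli_FE// indic_fubini_tonelli_GE// -torus_walkE => ->.
rewrite (eq_integral (cst (torus_uniform R A))).
  by rewrite integral_cst// [X in (_ * X)%E]probability_setT mule1.
move=> b _ /=; rewrite -[RHS](torus_uniform_translate b)//.
by rewrite /ysection; under eq_set do rewrite inE.
Qed.

Lemma torus_walk_char (r : nat) (a : torus R) :
  cintegral (torus_walk a) (torus_char r) =
  cintegral mu (torus_char r) * torus_char r a.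
Proof.
rewrite cintegral_distribution.
- rewrite mulrC -cintegralZl; last first.
    exact: (cintegrable_torus_char mu r (@measurable_id _ _ setT)).
  by congr cintegral; apply/funext => w; rewrite /= torus_charD.
- exact: measurable_Re_torus_char.
- exact: measurable_Im_torus_char.
- apply: (cintegrable_torus_char mu r).
  exact: measurable_fun_pair2 a measurable_torus_add.
Qed.

End torus_walk.

(** * Fair coins *)

Section binary_digits.
Context {R : realType}.
Local Notation leb := (@lebesgue_measure R).
Implicit Types (x : R) (n : nat) (w : nat -> bool).

(** For x in [0, 1[ this is the binary digit of weight 2 ^- n.+1, counted from n = 0; dyadic numbers
    get their terminating expansion. *)
Definition bit n x : bool := odd (Num.truncn (2 ^+ n.+1 * x)).

Lemma measurable_truncn (P : pred nat) :
  measurable [set x : R | P (Num.truncn x)].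
Proof.
have mlt n : measurable [set x : R | (Num.truncn x < n)%N].
  case: n => [|n]; first by rewrite (_ : [set _ | _] = set0)// -subset0.
  rewrite (_ : [set _ | _] = `]-oo, n.+1%:R[%classic)//.
  by apply/seteqP; split=> x /=; rewrite in_itv/= ltnS truncn_le_nat.
(* Each level set of [Num.truncn] is a difference of two lower rays. *)
rewrite (_ : [set _ | _] = \bigcup_(n in [set n | P n])
    ([set x | (Num.truncn x < n.+1)%N] `\` [set x | (Num.truncn x < n)%N])).
  by apply: bigcup_measurable => n _; exact: measurableD.
apply/seteqP; split => [x Px|x [n Pn [/= xn /negP]]].
  by exists (Num.truncn x) => //; split => //=; rewrite ltnn.
rewrite -leqNgt => nx; suff -> : Num.truncn x = n by [].
by apply/eqP; rewrite eqn_leq nx andbT.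
Qed.

Lemma measurable_bit n (b : bool) : measurable [set x | bit n x = b].
Proof.
have mf : measurable_fun [set: R] (fun x : R => 2 ^+ n.+1 * x).
  exact: measurable_funM.
have -> : [set x | bit n x = b] = (fun x => 2 ^+ n.+1 * x) @^-1`
    [set x | (fun k => odd k == b) (Num.truncn x)].
  by apply/seteqP; split=> x /= /eqP.
exact: (measurable_preimage mf (measurable_truncn (fun k => odd k == b))).
Qed.

(** Doubling moves the binary point by one place: the old integer part is half of the new one, and
    the parity is the digit that crossed the point. *)
Lemma truncn_double x : 0 <= x ->
  Num.truncn (2 * x) = ((Num.truncn x).*2 + odd (Num.truncn (2 * x)))%N.
Proof.
move=> x0; have x20 : 0 <= 2 * x by rewrite mulr_ge0.
suff -> : Num.truncn x = (Num.truncn (2 * x)%R)./2.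
  by rewrite addnC odd_double_half.
apply: truncn_def; have /andP[l u] := truncn_itv x20.
rewrite -natr1; set k := Num.truncn _ in l u *.
have kE : k%:R = (odd k)%:R + 2 * k./2%:R :> R.
  by rewrite -{1}(odd_double_half k) natrD -mul2n natrM.
rewrite -natr1 in u.
have o0 : 0 <= (odd k)%:R :> R by rewrite ler0n.
have o1 : (odd k)%:R <= 1 :> R by rewrite lern1 leq_b1.
by apply/andP; split; lra.
Qed.

(** The number m is the one whose binary numeral is w 0, ..., w (n - 1), leading digit first. *)
Lemma bit_prefix n w : exists2 m, (m < 2 ^ n)%N & forall x, 0 <= x < 1 ->
  (forall i, (i < n)%N -> bit i x = w i) <-> Num.truncn (2 ^+ n * x) = m.
Proof.
elim: n => [|n [m mn IH]].
  exists 0%N => // x /andP[x0 x1]; split => // _; rewrite expr0 mul1r.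
  by apply/eqP; rewrite truncn_eq// x0.
exists (m.*2 + w n)%N => [|x x01].
  by rewrite expnS mul2n; case: (w n); lia.
 have x0 : 0 <= x by case/andP: x01.
rewrite exprS -mulrA truncn_double ?mulr_ge0 ?exprn_ge0//.
rewrite mulrA -exprS -/(bit n x).
split=> [H|H].
  rewrite H//; congr (_.*2 + _)%N; apply/(IH x x01) => i ilt.
  exact/H/ltnW.
have [bn mE] : bit n x = w n /\ Num.truncn (2 ^+ n * x) = m.
  (* Parity recovers the last digit of the numeral. *)
  have bE : bit n x = w n.
    have := congr1 odd H; rewrite !oddD !odd_double.
    by case: (bit n x); case: (w n).
  by split => //; move: H; rewrite bE => /addIn/double_inj.
move=> i; rewrite ltnS leq_eqVlt => /orP[/eqP->//|]; exact: (IH x x01).2.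
Qed.

Definition bits_in (D : seq nat) w : set R :=
  [set x | 0 <= x < 1 /\ {in D, forall i, bit i x = w i}].

Lemma measurable_bits_in D w : measurable (bits_in D w).
Proof.
rewrite (_ : bits_in D w = `[0, 1[%classic `&`
    \bigcap_(i in [set` D]) [set x | bit i x = w i]); last first.
  by apply/seteqP; split=> x /= []; rewrite in_itv.
apply: measurableI => //; apply: bigcap_measurableType => i _.
exact: measurable_bit.
Qed.

(** Prescribing the first n digits cuts out the dyadic interval from m / 2 ^ n to (m + 1) / 2 ^
    n. *)
Lemma leb_bits_in_iota n w : leb (bits_in (iota 0 n) w) = (2 ^- n)%:E.
Proof.
have [m mn mE] := bit_prefix n w.
have p0 : 0 < 2 ^+ n :> R by rewrite exprn_gt0.
rewrite (_ : bits_in _ _ = `[m%:R / 2 ^+ n, m.+1%:R / 2 ^+ n[%classic).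
  rewrite lebesgue_measure_itv/= lte_fin ltr_pM2r ?invr_gt0// ltr_nat ltnSn.
  by rewrite -EFinB -mulrBl -natr1 addrAC subrr add0r mul1r.
have itvE x : 0 <= x -> (Num.truncn (2 ^+ n * x) == m) =
    (m%:R / 2 ^+ n <= x < m.+1%:R / 2 ^+ n).
  move=> x0; rewrite truncn_eq ?mulr_ge0 ?exprn_ge0//.
  by rewrite ler_pdivrMr// ltr_pdivlMr// [x * _]mulrC.
apply/seteqP; split=> x; rewrite /bits_in /= in_itv /=.
  move=> [x01 xw]; rewrite -itvE; last by case/andP: x01.
  by apply/eqP/(mE _ x01) => i ilt; apply: xw; rewrite mem_iota.
move=> xm; have x0 : 0 <= x.
  by case/andP: xm => + _; apply: le_trans; rewrite divr_ge0// ltW.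
(* The bound m < 2 ^ n keeps the dyadic interval inside [0, 1[. *)
have x01 : 0 <= x < 1.
  rewrite x0 /=; case/andP: xm => _ /lt_le_trans; apply.
  by rewrite ler_pdivrMr// mul1r -natrX ler_nat.
split=> // i; rewrite mem_iota => ilt.
by apply: (mE _ x01).2 => //; apply/eqP; rewrite itvE.
Qed.

(** Induction on the number of positions below N missing from [D]. If none is missing, the
    prescribed digits form an initial segment; otherwise the set splits along the two values of a
    missing digit j, and both halves are known by induction. *)
Lemma leb_bits_in D w : uniq D -> leb (bits_in D w) = (2 ^- size D)%:E.
Proof.
pose N := (\max_(i <- D) i).+1.
have : {subset D <= iota 0 N}.
  by move=> i iD; rewrite mem_iota /= ltnS leq_bigmax_seq.
move: (N) => {}N; have [k] := ubnP (N - size D).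
elim: k D w => // k IH D w Dk DN uD.
have [/allP ND|/allPn[j jN jD]] := boolP (all [in D] (iota 0 N)).
  have DE : perm_eq D (iota 0 N).
    apply: uniq_perm => // [|i]; first exact: iota_uniq.
    by apply/idP/idP => [/DN|/ND].
  rewrite (perm_size DE) size_iota -(leb_bits_in_iota N w); congr (leb _).
  apply/seteqP; split=> x [x01 xw]; split=> // i iD; apply: xw.
    by rewrite (perm_mem DE).
  by rewrite -(perm_mem DE).
have sDN : (size D < N)%N.
  have : uniq (j :: D) by rewrite /= jD.
  move/uniq_leq_size => /(_ (iota 0 N)); rewrite size_iota; apply.
  by move=> i; rewrite inE => /orP[/eqP->//|/DN].
have IHj w' : leb (bits_in (j :: D) w') = (2 ^- (size D).+1)%:E.
  apply: IH => /=; last by rewrite jD.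
    exact: leq_trans (ltn_sub2l sDN (ltnSn _)) Dk.
  by move=> i; rewrite inE => /orP[/eqP->//|/DN].
(* [w'] prescribes the opposite value of digit j. *)
pose w' i := if i == j then ~~ w i else w i.
have -> : bits_in D w = bits_in (j :: D) w `|` bits_in (j :: D) w'.
  apply/seteqP; split=> x.
    move=> [x01 xw]; have [xj|xj] := eqVneq (bit j x) (w j); [left|right];
      split => // i; rewrite inE => /orP[/eqP->//|iD].
    - exact: xw.
    - by rewrite /w' eqxx; case: (bit j x) (w j) xj => -[].
    - by rewrite /w' ifN ?xw//; apply: contraNneq jD => <-.
  case=> -[x01 xw]; split => // i iD; first by apply: xw; rewrite inE iD orbT.
  rewrite xw ?inE ?iD ?orbT// /w' ifN//.
  by apply: contraNneq jD => <-.
rewrite measureU; [|exact: measurable_bits_in|exact: measurable_bits_in|].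
  rewrite [X in (X + _)%E]IHj [X in (_ + X)%E]IHj -EFinD; congr EFin.
  by rewrite [RHS]splitr exprSr invfM.
apply/seteqP; split=> // x [[_ /(_ j)] + [_ /(_ j)]].
rewrite inE eqxx /= => /(_ isT) -> /(_ isT).
by rewrite /w' eqxx; case: (w j).
Qed.

End binary_digits.

(** * The space of coin sequences over a countable index type *)

Section coin.
Context {I : countType}.
Implicit Types (D : seq I) (w s : I -> bool).

Definition cylinder D w : set (I -> bool) :=
  [set s : I -> bool | {in D, s =1 w}].

(** The empty set makes the family closed under intersection, since two cylinders may be
    disjoint. *)
Definition cylinders : set (set (I -> bool)) :=
  [set A | A = set0 \/ exists D w, A = cylinder D w].

Definition coin := g_sigma_algebraType cylinders.

Lemma measurable_cylinder D w : measurable (cylinder D w : set coin).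
Proof. by apply: sub_sigma_algebra; right; exists D, w. Qed.

Lemma cylinders_setI : setI_closed cylinders.
Proof.
move=> A B [->|[D [w ->]]]; first by rewrite set0I; left.
case=> [->|[D' [w' ->]]]; first by rewrite setI0; left.
(* A common point s, if there is one, prescribes the values on both lists of positions at once. *)
have [[s [sw sw']]|] := pselect (cylinder D w `&` cylinder D' w' !=set0).
  right; exists (D ++ D'), s; apply/seteqP; split=> t.
    move=> [tw tw'] i; rewrite mem_cat => /orP[iD|iD'].
      by rewrite tw// sw.
    by rewrite tw'// sw'.
  move=> ts; split=> i iD; first by rewrite ts ?mem_cat ?iD// sw.
  by rewrite ts ?mem_cat ?iD ?orbT// sw'.
by move/set0P/negP; rewrite negbK => /eqP ->; left.
Qed.

Lemma cylinder_undup D w : cylinder (undup D) w = cylinder D w.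
Proof.
by apply/seteqP; split=> s sw i iD; apply: sw; rewrite ?mem_undup in iD *.
Qed.

Lemma cylinder_nil w : cylinder [::] w = setT.
Proof. exact/seteqP. Qed.

Lemma measurable_fun_coin d (T : measurableType d) (f : T -> coin) :
  (forall i b, measurable [set x | f x i = b]) -> measurable_fun [set: T] f.
Proof.
move=> mf; apply: (@measurability _ _ _ _ setT f cylinders) => // _ [A AC <-].
rewrite setTI; case: AC => [->|[D [w ->]]]; first by rewrite preimage_set0.
rewrite (_ : _ @^-1` _ = \bigcap_(i in [set` D]) [set x | f x i = w i]).
  by apply: fin_bigcap_measurable => [|i _]; [exact: finite_seq|exact: mf].
by apply/seteqP; split.
Qed.

Lemma measurable_coord (i : I) (b : bool) : measurable [set s : coin | s i = b].
Proof.
rewrite (_ : [set _ | _] = cylinder [:: i] (fun=> b)).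
  exact: measurable_cylinder.
apply/seteqP; split=> s /=; last by apply; rewrite inE.
by move=> sb j; rewrite inE => /eqP ->.
Qed.

Context {R : realType}.

(** Cylinders are a generating family closed under intersection. Repeated positions can be deleted,
    so it suffices to test lists where [size] counts the prescribed coins. *)
Lemma coin_measure_unique (m1 m2 : {measure set coin -> \bar R}) :
  (m1 setT < +oo)%E ->
  (forall D w, uniq D -> m1 (cylinder D w) = m2 (cylinder D w)) ->
  forall A, measurable A -> m1 A = m2 A.
Proof.
move=> m1oo m12 A mA.
apply: (@measure_unique _ _ coin cylinders (fun=> setT)) => //.
- exact: cylinders_setI.
- by move=> _; right; exists [::], (fun=> true); rewrite cylinder_nil.
- by apply/seteqP; split=> // s _; exists 0%N.
- move=> _ [->|[D [w ->]]]; first by rewrite !measure0.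
  by rewrite -cylinder_undup m12// undup_uniq.
Qed.

(** Since [pickle] is injective, distinct indices read distinct binary digits of x. *)
Definition toss (x : measurableTypeR R) : coin := fun i => bit (pickle i) x.

Lemma measurable_toss : measurable_fun [set: measurableTypeR R] toss.
Proof. by apply: measurable_fun_coin => i b; exact: measurable_bit. Qed.

HB.instance Definition _ := isMeasurableFun.Build _ _ _ _ toss measurable_toss.

Definition coin_prob : probability coin R :=
  distribution (uniform_prob (@ltr01 R)) toss.

Lemma coin_prob_cylinder D w :
  uniq D -> coin_prob (cylinder D w) = (2 ^- size D)%:E.
Proof.
move=> uD; rewrite /coin_prob /= /distribution /pushforward uniform_prob01E.
  (* The prescription is carried to digit positions; [false] fills those that code no index. *)
  pose w' n := if unpickle n is Some i then w i else false.
  rewrite -(size_map pickle) -(@leb_bits_in _ _ w').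
    congr (lebesgue_measure _).
    apply/seteqP; split=> x; rewrite /bits_in /= in_itv/=.
      move=> [xw x01]; split=> // _ /mapP[i iD ->].
      by rewrite /w' pickleK; exact: xw.
    move=> [x01 xw]; split=> // i iD.
    by have := xw _ (map_f pickle iD); rewrite /w' pickleK.
  by rewrite map_inj_uniq//; exact: pcan_inj pickleK.
exact: measurable_preimage measurable_toss (measurable_cylinder D w).
Qed.

End coin.
Arguments coin I : clear implicits.
Arguments coin_prob I R : clear implicits.

(** * Independence and reindexing of coins *)

Section merge.
Context {I : countType} {R : realType} (J : pred I).
Local Notation nu := (coin_prob I R).

Definition merge (z : coin I * coin I) : coin I :=
  fun i => if J i then z.1 i else z.2 i.

Lemma measurable_merge : measurable_fun setT merge.
Proof.
apply: measurable_fun_coin => i b; rewrite /merge.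
case: (J i).
  exact: (measurable_preimage measurable_fst (measurable_coord i b)).
exact: (measurable_preimage measurable_snd (measurable_coord i b)).
Qed.

HB.instance Definition _ :=
  isMeasurableFun.Build _ _ _ _ merge measurable_merge.

(* Coordinates in [J] and outside [J] are independent. *)
Lemma merge_coin_prob (A : set (coin I)) : measurable A ->
  (nu \x nu)%E (merge @^-1` A) = nu A.
Proof.
move=> mA; rewrite -[LHS]/(distribution (nu \x nu)%E merge A).
apply: coin_measure_unique mA => [|D w uD].
  by rewrite [ltLHS]probability_setT ltry.
(* A cylinder pulls back to a rectangle whose sides prescribe the coins of [D] inside and outside
   [J]; the exponents add up to [size D]. *)
have mergeE : merge @^-1` cylinder D w =
    cylinder [seq i <- D | J i] w `*` cylinder [seq i <- D | ~~ J i] w.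
  apply/seteqP; split=> -[s t]; rewrite /cylinder /merge /=.
    move=> stw; split=> i; rewrite mem_filter => /andP[Ji iD];
      by have := stw i iD; rewrite ?Ji ?(negbTE Ji).
  move=> [sw tw] i iD; case: ifPn => Ji; [apply: sw|apply: tw];
    by rewrite mem_filter Ji.
rewrite -[LHS]/((nu \x nu)%E (merge @^-1` cylinder D w)) mergeE.
rewrite product_measure1E; [|exact: measurable_cylinder..].
rewrite [X in (X * _)%E]coin_prob_cylinder ?filter_uniq//.
rewrite [X in (_ * X)%E]coin_prob_cylinder ?filter_uniq//.
rewrite [RHS]coin_prob_cylinder// -EFinM -invfM -exprD.
by rewrite !size_filter count_predC.
Qed.

End merge.

Section coin_row.
Context {I K : countType} {R : realType} (h : K -> I).

Definition coin_comap (s : coin I) : coin K := s \o h.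

Lemma measurable_coin_comap : measurable_fun setT coin_comap.
Proof. by apply: measurable_fun_coin => k b; exact: measurable_coord. Qed.

HB.instance Definition _ :=
  isMeasurableFun.Build _ _ _ _ coin_comap measurable_coin_comap.

(** An injective reindexing pulls a cylinder back to one with as many prescribed coins. *)
Lemma coin_comap_prob (A : set (coin K)) : injective h -> measurable A ->
  coin_prob I R (coin_comap @^-1` A) = coin_prob K R A.
Proof.
move=> hI mA; rewrite -[LHS]/(distribution (coin_prob I R) coin_comap A).
apply: coin_measure_unique mA => [|D w uD].
  by rewrite [ltLHS]probability_setT ltry.
(* This transports [w] along [h] without an inverse of [h]. *)
pose w' i := has [pred k | (h k == i) && w k] D.
have w'E j : j \in D -> w' (h j) = w j.
  move=> jD; apply/hasP/idP => [[l _ /andP[/eqP/hI-> //]]|wj].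
  by exists j; rewrite //= eqxx.
have comapE : coin_comap @^-1` cylinder D w = cylinder (map h D) w'.
  apply/seteqP; split=> s sw.
    by move=> _ /mapP[j jD ->]; rewrite w'E//; exact: sw.
  by move=> j jD; rewrite -w'E//; apply: sw; exact: map_f.
rewrite -[LHS]/(coin_prob I R (coin_comap @^-1` cylinder D w)) comapE.
rewrite [LHS]coin_prob_cylinder ?map_inj_uniq// [RHS]coin_prob_cylinder//.
by rewrite size_map.
Qed.

End coin_row.

(** * A uniform number from a sequence of coins *)

Section uniform_of_coins.
Context {R : realType}.
Local Notation leb := (@lebesgue_measure R).

(** In the extended reals the series of nonnegative terms has a value at once, and measurability of
    such sums applies. *)
Definition binary_value (s : coin nat) : R :=
  fine (\sum_(0 <= k <oo) ((s k)%:R * 2 ^- k.+1)%:E)%E.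

Lemma measurable_binary_value : measurable_fun setT binary_value.
Proof.
apply: measurableT_comp => //.
rewrite (_ : (fun _ => _) = fun s : coin nat =>
  (\sum_(k <oo | k \in predT) ((s k)%:R * 2 ^- k.+1)%:E)%E).
  apply: ge0_emeasurable_sum => k *.
    by rewrite lee_fin mulr_ge0// invr_ge0 exprn_ge0.
  apply/measurable_EFinP; apply: measurable_funM => //.
  rewrite (_ : (fun _ => _) = \1_([set s : coin nat | s k = true])).
    by apply: measurable_indic; exact: (measurable_coord k true).
  apply/funext => s; rewrite indicE; congr (_ %:R).
  by congr nat_of_bool; apply/idP/idP; rewrite inE.
by apply/funext => s; apply: eq_eseriesl.
Qed.

HB.instance Definition _ :=
  isMeasurableFun.Build _ _ _ _ binary_value measurable_binary_value.

(** The first n digits give x rounded down to a multiple of 2 ^- n; [truncn_double] is the inductive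
    step. *)
Lemma sum_bits n (x : R) : 0 <= x < 1 ->
  \sum_(0 <= k < n) (bit k x)%:R * 2 ^- k.+1 =
  (Num.truncn (2 ^+ n * x))%:R * 2 ^- n :> R.
Proof.
move=> /andP[x0 x1]; elim: n => [|n IH].
  rewrite big_geq// expr0 mul1r (_ : Num.truncn x = 0%N) ?mul0r//.
  by apply/eqP; rewrite truncn_eq// x0.
have p0 : 2 ^+ n != 0 :> R by rewrite expf_neq0.
rewrite big_nat_recr//= IH /bit exprS -mulrA [in RHS]truncn_double.
  by rewrite natrD -mul2n natrM; field.
by rewrite mulr_ge0// exprn_ge0.
Qed.

(** On [nat], [pickle] is the identity, so the terms are the digits of x in order; the partial sums
    are squeezed between x - 2 ^- n and x. *)
Lemma binary_value_toss (x : R) : 0 <= x < 1 -> binary_value (toss x) = x.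
Proof.
move=> x01; have /andP[x0 x1] := x01.
rewrite /binary_value (_ : (\sum_(0 <= k <oo) _)%E = x%:E)//.
apply/cvg_lim => //.
under eq_fun do rewrite sumEFin (sum_bits _ x01).
apply: cvg_EFin; first exact: nearW.
have t0 : (fun n => x - 2 ^- n) @ \oo --> x.
  rewrite -[X in _ --> X]subr0; apply: cvgB; first exact: cvg_cst.
  under eq_fun do rewrite -exprVn.
  by apply: cvg_expr; rewrite ger0_norm ?invr_ge0// invf_lt1// ltr1n.
apply: squeeze_cvgr t0 (cvg_cst x) => //; near=> n => /=.
have p0 : 0 < 2 ^+ n :> R by rewrite exprn_gt0.
have /andP[l u] := truncn_itv (mulr_ge0 (ltW p0) x0).
rewrite lerBlDr -[X in _ + X]mul1r -mulrDl natr1 ler_pdivlMr// ler_pdivrMr//.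
by rewrite [x * _]mulrC l andbT ltW.
Unshelve. all: by end_near. Qed.

(** [coin_prob] is the image of the uniform law under [toss], which [binary_value] inverts on [0,
    1[. *)
Lemma binary_value_prob (A : set R) : measurable A ->
  coin_prob nat R (binary_value @^-1` A) = uniform_prob (@ltr01 R) A.
Proof.
move=> mA; rewrite -[LHS]/(uniform_prob (@ltr01 R)
  (toss @^-1` (binary_value @^-1` A))).
rewrite !uniform_prob01E//.
  congr (leb _); apply/seteqP; split=> x /=; rewrite in_itv /= => -[+ x01];
  by rewrite binary_value_toss.
apply: measurable_preimage; first exact: measurable_toss.
exact: measurable_preimage measurable_binary_value mA.
Qed.

End uniform_of_coins.

(** * Quantiles *)

Section quantile.
Context d (Omega : measurableType d) {R : realType} (P : probability Omega R).
Variable X : {RV P >-> R}.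
Implicit Types u x : R.

Local Notation F := (fun x => fine (cdf X x)).

(* Outside ]0, 1[ the infimum could be that of an empty or unbounded set. *)
Definition quantile (u : measurableTypeR R) : R :=
  if 0 < (u : R) < 1 then inf [set x | (u : R) <= F x] else 0.

Let F_nd x y : x <= y -> F x <= F y.
Proof. by move=> xy; rewrite fine_le ?fin_num_measure// cdf_nondecreasing. Qed.

(** The limits of the distribution function at both infinities make the set nonempty and bounded
    below; right continuity puts its infimum in the set. *)
Lemma quantile_le u x : 0 < u < 1 -> (quantile u <= x) = (u <= F x).
Proof.
move=> u01; rewrite /quantile u01; case/andP: u01 => u0 u1.
have lb : has_lbound [set x | u <= F x].
  have F0 : F @ -oo --> (0 : R) by exact/fine_cvg/cvg_cdfNy0.
  have [y /= Fyu] := filter_ex (cvgr_lt _ F0 _ u0).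
  exists y => z /= uFz; rewrite leNgt; apply/negP => zy.
  by have := lt_le_trans (le_lt_trans (F_nd (ltW zy)) Fyu) uFz; rewrite ltxx.
have ne : [set x | u <= F x] !=set0.
  have F1 : F @ +oo --> (1 : R) by exact/fine_cvg/cvg_cdfy1.
  by have [y /= /ltW Fyu] := filter_ex (cvgr_gt _ F1 _ u1); exists y.
apply/idP/idP => [qx|ux]; last exact: ge_inf.
have Fx : F y @[y --> x^'+] --> F x.
  apply: fine_cvg; rewrite fineK ?fin_num_measure//.
  exact: cdf_right_continuous.
apply: (cvgr_to_ge Fx); near=> y.
have xy : x < y by near: y; exact: nbhs_right_gt.
have [z uz zy] := inf_lt ne (le_lt_trans qx xy).
exact: le_trans uz (F_nd (ltW zy)).
Unshelve. all: by end_near. Qed.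

Lemma measurable_quantile : measurable_fun [set: measurableTypeR R] quantile.
Proof.
apply: (measurability _ (RGenOInfty.measurableE R)) => // _ [_ [x ->] <-].
(* Inside ]0, 1[ the condition reads F x < u; outside, the value is the default 0, so only the sign
   of x matters. *)
rewrite setTI (_ : _ @^-1` _ = (`]0, 1[ `&` `]F x, +oo[) `|`
    (~` `]0, 1[ `&` [set u | x < 0])).
  apply: measurableU; apply: measurableI => //; first exact: measurableC.
  rewrite (_ : [set _ | _] = if x < 0 then setT else set0).
    by case: ifP.
  by apply/seteqP; split=> u /=; case: (x < 0).
apply/seteqP; split=> u /=; rewrite !in_itv/= !andbT.
  have [u01|u01] := boolP (0 < u < 1).
    by rewrite ltNge quantile_le// -ltNge => ?; left.
  by rewrite /quantile (negbTE u01) => x0; right; split => //; exact/negP.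
move=> [[u01]|[/negP u01 x0]]; first by rewrite ltNge -quantile_le// -ltNge.
by rewrite /quantile (negbTE u01).
Qed.

HB.instance Definition _ :=
  isMeasurableFun.Build _ _ _ _ quantile measurable_quantile.

(** Upper rays generate the Borel sets, and by [quantile_le] both laws give ]x, +oo[ the mass 1 - F
    x. *)
Lemma quantile_prob (A : set R) : measurable A ->
  uniform_prob (@ltr01 R) (quantile @^-1` A) = distribution P X A.
Proof.
move=> mA; rewrite -[LHS]/(distribution (uniform_prob (@ltr01 R)) quantile A).
apply: (@measure_unique _ R (R : measurableType _) (@RGenOInfty.G R)
  (fun k => `]- k%:R, +oo[%classic)) mA.
- exact: RGenOInfty.measurableE.
- move=> _ _ [x ->] [y ->]; exists (Num.max x y).
  by apply/seteqP; split=> z /=; rewrite !in_itv/= !andbT gt_max => /andP.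
- by move=> k; exists (- k%:R).
- apply/seteqP; split=> // x _; exists (Num.truncn `|x|).+1 => //=.
  rewrite in_itv/= andbT ltrNl (le_lt_trans _ (truncnS_gt _))//.
  by rewrite -normrN ler_norm.
- move=> _ [x ->].
  rewrite -[LHS]/(uniform_prob (@ltr01 R) (quantile @^-1` `]x, +oo[)).
  rewrite uniform_prob01Eo; last first.
    exact: measurable_preimage measurable_quantile _.
  rewrite (_ : _ `&` _ = `]F x, 1[%classic); last first.
    apply/seteqP; split=> u /=; rewrite !in_itv/= !andbT.
      move=> [+ u01]; rewrite ltNge quantile_le// -ltNge => ->.
      by case/andP: u01.
    move=> /andP[Fu u1]; have u01 : 0 < u < 1.
      by rewrite u1 andbT (le_lt_trans _ Fu)// fine_ge0.
    by split => //; rewrite ltNge quantile_le// -ltNge.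
  rewrite lebesgue_measure_itv/= lte_fin.
  have cdf_fin : cdf X x \is a fin_num by rewrite fin_num_measure.
  have ccdf_fin : ccdf X x \is a fin_num by rewrite fin_num_measure.
  have ccdf0 : 0 <= fine (ccdf X x) by rewrite fine_ge0.
  have F1 : fine (cdf X x) + fine (ccdf X x) = 1.
    by apply: EFin_inj; rewrite EFinD !fineK// cdf_ccdf_1.
  rewrite -[RHS]/(ccdf X x) -[RHS](fineK ccdf_fin).
  (* If F x < 1 fails, the interval is empty and the upper tail has mass 0. *)
  case: ifPn => [_|]; rewrite -?leNgt -?EFinB; [|move=> Fx1]; congr EFin; lra.
- by move=> k; rewrite (le_lt_trans (probability_le1 _ _))// ltry.
Qed.

End quantile.

(** * Random walk *)

Section random_walk.
Context {R : realType} (mu : probability (torus R) R)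
  (g : {mfun coin nat >-> torus R}).
Hypothesis gmu : forall A, measurable A -> coin_prob nat R (g @^-1` A) = mu A.
Local Notation nu := (coin_prob (nat * nat)%type R).

(** The coins form a double array; row t feeds the step from time t to time t + 1. *)
Definition row (t : nat) : coin (nat * nat)%type -> coin nat :=
  coin_comap (pair t).

Definition walk (t : nat) (s : coin (nat * nat)%type) : torus R :=
  \sum_(i < t) g (row i s).

Let measurable_step t : measurable_fun setT (fun s => g (row t s)).
Proof.
apply: measurableT_comp; first exact: measurable_funP.
exact: measurable_coin_comap.
Qed.

Lemma walkS t s : walk t.+1 s = walk t s + g (row t s).
Proof. by rewrite /walk big_ord_recr. Qed.

Let measurable_walk t : measurable_fun setT (walk t).
Proof.
elim: t => [|t IH].
  rewrite (_ : walk 0 = cst 0); first exact: measurable_cst.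
  by apply/funext => s; rewrite /walk big_ord0.
rewrite (_ : walk t.+1 =
    (fun z => z.1 + z.2) \o (fun s => (walk t s, g (row t s)))).
  apply: measurableT_comp measurable_torus_add _.
  exact: measurable_fun_pair IH (measurable_step t).
by apply/funext => s; rewrite walkS.
Qed.

HB.instance Definition _ t :=
  isMeasurableFun.Build _ _ _ _ (walk t) (measurable_walk t).

Definition walk_rv (t : nat) : {RV nu >-> torus R} := walk t.

Lemma walk_eq t s s' : (forall i k, (i < t)%N -> s (i, k) = s' (i, k)) ->
  walk t s = walk t s'.
Proof.
move=> ss'; apply: eq_bigr => i _; congr (g _).
by apply/funext => k; apply: ss'.
Qed.

(** Both properties pass to complements and countable unions, and hold for the generating events
    because [walk r] with r <= t reads only rows before t. *)
Lemma history_walk t F : history walk_rv t F ->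
  measurable F /\ forall s s',
    (forall i k, (i < t)%N -> s (i, k) = s' (i, k)) -> F s = F s'.
Proof.
move: F; apply: smallest_sub.
  split=> [|F [mF FE]|F FE].
  - by split.
  - rewrite setTD; split; first exact: measurableC.
    by move=> s s' /FE FE'; rewrite /setC /= FE'.
  - split; first by apply: bigcup_measurable => k _; case: (FE k).
    move=> s s' ss'; apply/propext; split=> -[k _ Fk]; exists k => //.
      by rewrite -((FE k).2 s s').
    by rewrite ((FE k).2 s s').
move=> _ [r [A [rt mA ->]]]; split.
  exact: measurable_preimage (measurable_walk r) mA.
move=> s s' ss'; rewrite /preimage /= (@walk_eq r s s')// => i k ir.
by apply: ss'; exact: leq_trans ir rt.
Qed.

(* Redrawing the coins of all rows from [t] on does not change the law; it
   leaves [F] and [walk t] alone and makes step [t] independent of them. *)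
Lemma walk_markov : markov_process walk_rv (fun=> torus_walk mu).
Proof.
move=> t F A /history_walk[mF FE] mA.
have mS : measurable (F `&` walk t.+1 @^-1` A).
  apply: measurableI => //.
  exact: measurable_preimage (measurable_walk _) mA.
pose J := [pred p : nat * nat | (p.1 < t)%N].
(* The product measure integrates the masses of sections, taken over the redrawn coins; these are
   compared pointwise with the kernel, cut off outside [F]. *)
rewrite -[LHS](merge_coin_prob J)// /product_measure1 [RHS]integral_mkcond.
apply: eq_integral => s _ /=; rewrite patchE.
have walkJ s' : walk t (merge J (s, s')) = walk t s.
  by apply: walk_eq => i k it; rewrite /merge /= it.
have rowJ s' : row t (merge J (s, s')) = row t s'.
  by apply/funext => k; rewrite /row /merge /coin_comap /= ltnn.
have FJ s' : F (merge J (s, s')) = F s.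
  by apply: FE => i k it; rewrite /merge /= it.
rewrite (_ : xsection _ s =
    [set s' | F s /\ A (walk t s + g (row t s'))]); last first.
  by apply/seteqP; split=> s'; rewrite /xsection /= inE /= walkS walkJ rowJ FJ.
case: ifPn => [/set_mem Fs|/negP Fs]; last first.
  rewrite (_ : [set _ | _] = set0) ?measure0//.
  by apply/seteqP; split=> // s' [/mem_set].
rewrite (_ : [set _ | _] =
    row t @^-1` (g @^-1` (torus_shift (walk t s) @^-1` A))).
  rewrite [LHS]coin_comap_prob.
  - by rewrite gmu//; exact: measurable_funPTI.
  - by move=> ? ? [].
  - by do 2 apply: measurable_funPTI.
by apply/seteqP; split=> s' // -[].
Qed.

End random_walk.

(** * Sampling a step of the walk from coins *)

HB.instance Definition _ (R : realType) :=
  isMeasurableFun.Build _ _ _ _ (@torus_pi R) (@measurable_torus_pi R).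

Section torus_sampler.
Context d (Omega : measurableType d) {R : realType} (P : probability Omega R).
Variable W : {RV P >-> R}.

Definition torus_sampler (s : coin nat) : torus R :=
  torus_pi (quantile W (binary_value s)).

Let measurable_torus_sampler : measurable_fun setT torus_sampler.
Proof.
apply: measurableT_comp; first exact: measurable_torus_pi.
exact: measurableT_comp (measurable_quantile W) measurable_binary_value.
Qed.

HB.instance Definition _ :=
  isMeasurableFun.Build _ _ _ _ torus_sampler measurable_torus_sampler.

(** Inverse transform sampling: [binary_value_prob] turns coins into a uniform number, and
    [quantile_prob] turns that into the law of [W]. *)
Lemma torus_sampler_prob A : measurable A ->
  coin_prob nat R (torus_sampler @^-1` A) = distribution P (torus_pi \o W) A.
Proof.
move=> mA.
have mE : measurable (@torus_pi R @^-1` A) by exact: measurable_funPTI.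
rewrite -[RHS]/(distribution P W (torus_pi @^-1` A)) -quantile_prob//.
rewrite -binary_value_prob//.
exact: measurable_preimage (measurable_quantile W) mE.
Qed.

End torus_sampler.

(** * The two directions of the equivalence *)

Section pker_at.
Context d d' (X : measurableType d) (Y : measurableType d') (R : realType).

(** A named copy of the kernel at a point, so that it can carry the structure of a probability. *)
Definition pker_at (K : R.-pker X ~> Y) (x : X) : set Y -> \bar R := K x.

HB.instance Definition _ (K : R.-pker X ~> Y) (x : X) :=
  Measure.on (pker_at K x).
HB.instance Definition _ (K : R.-pker X ~> Y) (x : X) :=
  Measure_isProbability.Build _ _ _ (pker_at K x) (prob_kernel x).

End pker_at.

(** The torus itself, under the kernel at 0, serves as probability space, and the fractional part as
    [W]. *)
Lemma rv_of_pker (R : realType) (rho : nat -> R[i])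
    (K : R.-pker torus R ~> torus R) :
  (forall r, cintegral (K (torus_pi 0)) (torus_char r) = rho r) ->
  exists (d : measure_display) (Omega : measurableType d)
     (P : probability Omega R) (W : {RV P >-> R}),
    (forall w : Omega, 0 <= W w <= 1) /\
    (forall r : nat, rho r = cintegral P (fun w => expi2pi (r%:R * W w))).
Proof.
move=> Krho.
exists _, (torus R), (pker_at K (torus_pi 0)), torus_frac; split=> [b|r] /=.
  by have /andP[-> /ltW ->] := torus_frac_itv b.
rewrite -Krho; congr cintegral.
by apply/funext => b; rewrite torus_char_frac.
Qed.

Theorem proposition4 (R : realType) (rho : nat -> R[i]) :
  (exists (d : measure_display) (Omega : measurableType d)
     (P : probability Omega R) (B : nat -> {RV P >-> torus R})
     (K : nat -> R.-pker torus R ~> torus R),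
    [/\ markov_process B K,
        time_homogeneous K,
        stationary_distribution K (torus_uniform R) &
        forall (t r : nat) (a : R), (0 < t)%N -> 0 <= a <= 1 ->
          cond_expectation K t (torus_char r) (torus_pi a) =
          rho r * expi2pi (r%:R * a)])
  <->
  (exists (d : measure_display) (Omega : measurableType d)
     (P : probability Omega R) (W : {RV P >-> R}),
    (forall w : Omega, 0 <= W w <= 1) /\
    (forall r : nat, rho r = cintegral P (fun w => expi2pi (r%:R * W w)))).
Proof.
split=> [[d [T [P [B [K [_ _ _ Kchar]]]]]]|].
  apply: (@rv_of_pker R rho (K 0%N)) => r.
  (* Time 1 selects the kernel [K 0], and at a = 0 the exponential factor is 1. *)
  have := Kchar 1%N r 0 isT; rewrite lexx ler01 => /(_ isT).
  by rewrite /cond_expectation mulr0 expi2pi0 mulr1.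
move=> [d [T [P [W [_ rhoE]]]]].
(* The step law is that of [W] modulo 1. *)
pose mu : probability (torus R) R := distribution P (torus_pi \o W).
exists _, (coin (nat * nat)%type), (coin_prob _ R), (walk_rv (torus_sampler W)).
exists (fun=> torus_walk mu); split=> //.
- exact: walk_markov (torus_sampler_prob W).
- by move=> t A; exact: torus_walk_uniform.
- move=> t r a _ _; rewrite /cond_expectation torus_walk_char torus_charE.
  congr (_ * _); rewrite cintegral_distribution.
  + by rewrite rhoE; congr cintegral; apply/funext => w; rewrite /= torus_charE.
  + exact: measurable_Re_torus_char.
  + exact: measurable_Im_torus_char.
  + apply: (@cintegrable_torus_char _ _ _ P r (torus_pi \o W)).
    exact: measurable_funP.
Qed.
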